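(* Let $\alpha, \beta \in \mathbb{R}$, let $n \in \mathbb{N}$ with $n \geq 2$, and let $f \in C_0^{\infty}(\mathbb{R}^n \setminus \{0\})$. Then $$ \begin{aligned} \int_{\mathbb{R}^n} |(\Delta f)(x)|^2 \, d^n x & \geq [(n - 4) \alpha - 2 \beta] \int_{\mathbb{R}^n} |x|^{-2} |(\nabla f)(x)|^2 \, d^n x \\ & \quad - \alpha (\alpha - 4) \int_{\mathbb{R}^n} |x|^{-4} |x \cdot (\nabla f)(x)|^2 \, d^n x \\ & \quad + \beta [(n - 4) (\alpha - 2) - \beta] \int_{\mathbb{R}^n} |x|^{-4} |f(x)|^2 \, d^n x . \end{aligned} $$ In addition, if either $\alpha \leq 0$ or $\alpha \geq 4$, then $$ \begin{aligned} \int_{\mathbb{R}^n} |(\Delta f)(x)|^2 \, d^n x & \geq [\alpha (n - \alpha) - 2 \beta] \int_{\mathbb{R}^n} |x|^{-2} |(\nabla f)(x)|^2 \, d^n x \\ & \quad + \beta [(n - 4) (\alpha - 2) - \beta] \int_{\mathbb{R}^n} |x|^{-4} |f(x)|^2 \, d^n x . \end{aligned} $$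
   Context: $C_0^{\infty}(\mathbb{R}^n \setminus \{0\})$ denotes the space of smooth (complex-valued) functions whose support is a compact subset of $\mathbb{R}^n \setminus \{0\}$. $\Delta$ is the Laplacian, $\nabla$ the gradient, $|x|$ the Euclidean norm, $x \cdot (\nabla f)(x) = \sum_{j=1}^n x_j (\partial f/\partial x_j)(x)$, and $d^n x$ is Lebesgue measure on $\mathbb{R}^n$. *)

(* Defs.v *)
From HB Require Import structures.
From mathcomp Require Import all_boot all_order all_algebra.
From mathcomp Require Import all_classical all_reals all_analysis.
From mathcomp.real_closed Require Import complex.
Set Implicit Arguments.
Unset Strict Implicit.
Unset Printing Implicit Defensive.
Import Order.TTheory GRing.Theory Num.Theory.
Import numFieldNormedType.Exports.
Import ComplexField.Normc.
Local Open Scope classical_set_scope.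
Local Open Scope ring_scope.
Local Open Scope complex_scope.

Section LebesgueRn.
Context {R : realType}.
Local Open Scope ereal_scope.
Local Notation mR := (measurableTypeR R).

Definition tcons n (p : mR * n.-tuple mR) : n.+1.-tuple mR :=
  [tuple of p.1 :: p.2].

Lemma measurable_tcons n : measurable_fun setT (@tcons n).
Proof. exact: measurable_cons. Qed.

Section step.
Variables (n : nat) (m : {sigma_finite_measure set (n.-tuple mR) -> \bar R}).

Definition lebesgue_cons : set (n.+1.-tuple mR) -> \bar R :=
  pushforward (@lebesgue_measure R \x m) (@tcons n).

HB.instance Definition _ := Measure.copy lebesgue_cons
  (measure_function_pushforward__canonical__measure_function_Measure
     (@lebesgue_measure R \x m) (@measurable_tcons n)).

(* The library's sigma-finite instance on m1 \x m2 is not inferred here (it is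
   shadowed by the one for pairs of subprobabilities), hence a direct proof. *)
Let lebesgue_cons_sigma_finite : sigma_finite setT lebesgue_cons.
Proof.
have [F [UF ndF Ffin]] := (sigma_finiteP _ _).1
  (sigma_finiteT (@lebesgue_measure R)).
have [G [UG ndG Gfin]] := (sigma_finiteP _ _).1 (sigma_finiteT m).
exists (fun k => (fun t : n.+1.-tuple mR => thead t) @^-1` F k `&`
                 (fun t : n.+1.-tuple mR => [tuple of behead t]) @^-1` G k).
  apply/seteqP; split=> // t _.
  have [i _ Fi] : (\bigcup_i F i) (thead t) by rewrite -UF.
  have [j _ Gj] : (\bigcup_i G i) [tuple of behead t] by rewrite -UG.
  exists (maxn i j) => //; split.
    by have /subsetPset := ndF _ _ (leq_maxl i j); apply.
  by have /subsetPset := ndG _ _ (leq_maxr i j); apply.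
move=> k; have [mF Foo] := Ffin k; have [mG Goo] := Gfin k; split.
  apply: measurableI; rewrite -[X in measurable X]setTI.
    exact: measurable_tnth.
  exact: measurable_behead.
rewrite /lebesgue_cons /pushforward.
rewrite (_ : _ @^-1` _ = F k `*` G k); last first.
  have cK p : [tuple of behead (@tcons n p)] = p.2 by exact: val_inj.
  by apply/seteqP; split=> p /=; rewrite cK /tcons theadE.
by rewrite product_measure1E// lte_mul_pinfty// ge0_fin_numE.
Qed.

HB.instance Definition _ := Measure_isSigmaFinite.Build _ _ _
  lebesgue_cons lebesgue_cons_sigma_finite.

End step.

(* Lebesgue measure on the product (i.e. Borel) sigma-algebra of R^n, as the
   n-fold product of the one-dimensional one; R^0 carries a unit point mass. *)
Fixpoint lebesgue_tuple n : {sigma_finite_measure set (n.-tuple mR) -> \bar R} :=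
  match n with
  | 0 => \d_([tuple] : 0.-tuple mR)
  | m.+1 => lebesgue_cons (lebesgue_tuple m)
  end.

End LebesgueRn.

(* The sigma-algebra lives on tuples while the topology and the derivatives live
   on row vectors, hence the change of representation. *)
Definition integral_Rn (R : realType) (n : nat) (g : 'rV[R]_n -> R) : R :=
  \int[lebesgue_tuple n]_t g (\row_i tnth t i).

Section Calculus.
Context {R : realType} {n : nat}.
Implicit Types (f : 'rV[R]_n -> R[i]) (x : 'rV[R]_n).

Definition partial (j : 'I_n) (g : 'rV[R]_n -> R) : 'rV[R]_n -> R :=
  fun x => 'D_(delta_mx 0 j) g x.

(* Derivatives 'D_v are total functions, so the existence of every iterated partial
   derivative has to be required explicitly. *)
Definition smooth (g : 'rV[R]_n -> R) : Prop :=
  forall s : seq 'I_n, let h := foldr partial g s in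
    continuous h /\ forall (j : 'I_n) x, derivable h x (delta_mx 0 j).

Definition csmooth f : Prop :=
  smooth (fun x => complex.Re (f x)) /\ smooth (fun x => complex.Im (f x)).

Definition csupport f : set 'rV[R]_n := closure [set x | f x != 0].

Definition C0infty_minus0 f : Prop :=
  [/\ csmooth f, compact (csupport f) & ~ csupport f 0].

(* R[i] carries no normed module structure over R, so derivatives are taken on
   the real and imaginary parts. *)
Definition cpartial (j : 'I_n) f : 'rV[R]_n -> R[i] :=
  fun x => partial j (fun y => complex.Re (f y)) x +i* partial j (fun y => complex.Im (f y)) x.

Definition gradient f x : 'rV[R[i]]_n := \row_j cpartial j f x.

Definition laplacian f x : R[i] := \sum_(j < n) cpartial j (cpartial j f) x.

Definition x_dot_gradient f x : R[i] :=
  \sum_(j < n) (x 0 j)%:C * gradient f x 0 j.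

(* The library norm on row vectors is the sup norm, hence these. *)
Definition enorm x : R := Num.sqrt (\sum_(j < n) x 0 j ^+ 2).

Definition cenorm (v : 'rV[R[i]]_n) : R :=
  Num.sqrt (\sum_(j < n) normc (v 0 j) ^+ 2).

End Calculus.

(* Main.v *)
(* For real u put w = |x|^-2, E = x . grad u, G = |grad u|^2, D = Lap u and
   T = - D + alpha w E + beta w u. Expanding the square shows that
     D^2 - [(n - 4) alpha - 2 beta] w G + alpha (alpha - 4) w^2 E^2
       - beta [(n - 4) (alpha - 2) - beta] w^2 u^2 = T^2 + div F
   for an explicit vector field F with compact support in R^n \ {0}; since the
   integral of div F vanishes, the first inequality follows from T^2 >= 0. The
   second one follows from the first by the pointwise bound w^2 E^2 <= w G.
   A complex f is split into its real and imaginary parts. *)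
From HB Require Import structures.
Require Import Defs.
From mathcomp Require Import all_boot all_order all_algebra.
From mathcomp Require Import all_classical all_reals all_analysis.
From mathcomp Require Import measurable_realfun.
From mathcomp.real_closed Require Import complex.
From mathcomp Require Import ring lra.
Import Order.TTheory GRing.Theory Num.Theory.
Import numFieldNormedType.Exports.
Import ComplexField.Normc.
Set Implicit Arguments.
Unset Strict Implicit.
Unset Printing Implicit Defensive.
Local Open Scope classical_set_scope.
Local Open Scope ring_scope.

(** * Neighbourhoods off a closed set and transport of directional derivatives *)

Lemma closed_nbhsC (T : topologicalType) (K : set T) x :
  closed K -> ~ K x -> nbhs x (~` K).
Proof.
by move=> cK Kx; apply: open_nbhs_nbhs; split => //; exact: closed_openC.
Qed.

(** The two difference quotients are the same function of [h]. This transports derivatives to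
    slices, lines and translates. *)
Lemma is_derive_along (R : realType) (V W : normedModType R)
    (f : V -> R) (g : W -> R) x v y w :
  (forall h : R, f (h *: v + x) = g (h *: w + y)) -> derivable g y w ->
  is_derive x v f ('D_w g y).
Proof.
move=> fg dg; have fxgy : f x = g y by have := fg 0; rewrite !scale0r !add0r.
have E : (fun h : R => h^-1 *: ((f \o shift x) (h *: v) - f x)) =
         (fun h => h^-1 *: ((g \o shift y) (h *: w) - g y)).
  by apply/funext => h /=; rewrite fg fxgy.
by apply: DeriveDef; rewrite /derivable/derive E.
Qed.

(** * Measurability and integrability on R^n *)

Section integration.
Context {R : realType}.
Local Notation mR := (measurableTypeR R).

(** Links the topology of row vectors to the product sigma-algebra: an open set is the union of the
    countably many cubes [B q], with rational centre and radius 1/(k+1), that it contains. *)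
Lemma open_measurable_row n (U : set 'rV[R]_n) : open U ->
  measurable [set t : n.-tuple mR | U (\row_i tnth t i)].
Proof.
move=> oU.
pose B (q : 'rV[rat]_n * nat) : set (n.-tuple mR) :=
  \bigcap_i [set t | `|ratr (q.1 0 i) - tnth t i| < q.2.+1%:R^-1].
pose V := [set t : n.-tuple mR | U (\row_i tnth t i)].
rewrite [X in measurable X](_ : _ =
    \bigcup_q (if `[< B q `<=` V >] then B q else set0)); last first.
  apply/seteqP; split => [t Ut|t [q _]]; last first.
    by case: asboolP => // + Bt; exact.
  have /nbhs_ballP[e /= e0 eU] := open_nbhs_nbhs (conj oU Ut).
  (* Half of [e]: two points of one cube are each within 1/(k+1) of its centre, hence within [e] of
     each other. *)
  have [k ke] : exists k, k.+1%:R^-1 < e / 2.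
    have := @near_infty_natSinv_lt R (PosNum (divr_gt0 e0 (ltr0Sn R 1))).
    by case=> k _ /(_ k (leqnn k)); exists k.
  have k0 : (0 : R) < k.+1%:R^-1 by rewrite invr_gt0.
  have rq (x : R) : {q : rat | `|ratr q - x| < k.+1%:R^-1}.
    apply/cid; have [|q] := @rat_in_itvoo R (x - k.+1%:R^-1) (x + k.+1%:R^-1).
      by rewrite ltrD2l (lt_trans _ k0)// oppr_lt0.
    by rewrite in_itv/= => xq; exists q; rewrite distrC ltr_distlC.
  exists (\row_i sval (rq (tnth t i)), k) => //.
  rewrite ifT//.
    by move=> i _ /=; rewrite mxE; case: rq.
  apply/asboolP => s Bs; apply: eU; split => // i j.
  have := Bs j I; rewrite /= !mxE; case: (rq _) => q /= qt qs.
  rewrite /ball/= -(subrKA (ratr q)) (le_lt_trans (ler_normD _ _))//.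
  by rewrite distrC [e]splitr ltrD// (lt_trans _ ke).
apply: countable_bigcupT_measurable => [|q]; first exact: countableP.
case: ifP => // _; apply: fin_bigcap_measurable; first exact: finite_finset.
move=> i _; rewrite -[X in measurable X]setTI.
have := measurable_tnth (T := mR) i measurableT
  (open_measurable (ball_open (ratr (q.1 0 i) : R) _)).
exact.
Qed.

Lemma continuous_measurable_row n (g : 'rV[R]_n -> R) : continuous g ->
  measurable_fun setT (fun t : n.-tuple mR => g (\row_i tnth t i)).
Proof.
move=> /continuousP cg; apply: (measurability _ (RGenOpens.measurableE R)).
move=> _ [_ [a [b ->] <-]]; rewrite setTI.
exact: open_measurable_row (cg _ (interval_open _ _)).
Qed.

Definition cube n (M : R) : set (n.-tuple mR) :=
  [set t : n.-tuple mR | forall i, tnth t i \in `[- M, M]].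
Arguments cube : clear implicits.

Lemma measurable_cube n (M : R) : measurable (cube n M).
Proof.
rewrite (_ : cube n M =
    \bigcap_(i in [set: 'I_n]) [set t | tnth t i \in `[- M, M]]); last first.
  by apply/seteqP; split => t /=; [move=> H i _; exact: H|move=> H i; exact: H].
apply: fin_bigcap_measurable; first exact: finite_finset.
move=> i _; rewrite -[X in measurable X]setTI.
exact: (measurable_tnth (T := mR) i measurableT (measurable_itv `[- M, M])).
Qed.

Lemma lebesgue_tuple_cube_lty n (M : R) : (lebesgue_tuple n (cube n M) < +oo)%E.
Proof.
elim: n => [|n IH].
  rewrite (_ : cube 0 M = setT); last by apply/seteqP; split => // t _ [].
  by rewrite /= /dirac indicE ltry.
rewrite /= /lebesgue_cons/= /pushforward.
rewrite (_ : _ @^-1` _ = `[- M, M] `*` cube n M); last first.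
  apply/seteqP; split=> -[x t] /=.
    move=> H; split; first by have := H ord0; rewrite /tcons tnth0.
    by move=> i; have := H (lift ord0 i); rewrite /tcons tnthS.
  move=> [/= Hx Ht] i; rewrite /tcons/=.
  by case: (unliftP ord0 i) => [j|] ->; rewrite ?tnthS ?tnth0.
rewrite product_measure1E//; last exact: measurable_cube.
rewrite lte_mul_pinfty//= lebesgue_measure_itv//=.
by case: ifPn; rewrite // -EFinB ltry.
Qed.

(** Stated coordinate by coordinate, so that every slice inherits the same [M]. *)
Definition bounded_support n (g : 'rV[R]_n -> R) :=
  exists M, forall x, g x != 0 -> forall i, x 0 i \in `[- M, M].

(** The function vanishes off a cube of finite measure, and on that compact cube continuity makes it
    bounded. *)
Lemma integrable_row n (g : 'rV[R]_n -> R) :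
  continuous g -> bounded_support g ->
  (lebesgue_tuple n).-integrable setT (fun t => (g (\row_i tnth t i))%:E).
Proof.
move=> cg [M gM].
pose G := (fun t : n.-tuple mR => g (\row_i tnth t i)).
have -> : (fun t => (G t)%:E) = (EFin \o G) \_ (cube n M).
  apply/funext => t; rewrite patchE; case: ifPn => //.
  rewrite notin_setE /= => H.
  have [->//|/gM g0] := eqVneq (G t) 0.
  by exfalso; apply: H => i; have := g0 i; rewrite mxE.
apply/(integrable_mkcond _ (@measurable_cube n M)).
apply: measurable_bounded_integrable.
- exact: measurable_cube.
- exact: lebesgue_tuple_cube_lty.
- exact: measurable_funTS (continuous_measurable_row cg).
have cK : compact [set x : 'rV[R]_n | forall i, x 0 i \in `[- M, M]].
  apply: (@rV_compact R n (fun=> `[- M, M]%classic)) => i.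
  exact: segment_compact.
have /compact_bounded[B [Br BM]] :
    compact (g @` [set x : 'rV[R]_n | forall i, x 0 i \in `[- M, M]]).
  by apply: continuous_compact => //; exact: continuous_subspaceT.
exists B; split => // x /BM {}BM t /= Mt; apply: BM => /=.
by eexists; last reflexivity; move=> i; rewrite /= mxE; exact: Mt.
Qed.

(** * Slicing along the first coordinate, and integrals of partial derivatives *)

Definition cons_row n (a : R) (v : 'rV[R]_n) : 'rV[R]_n.+1 :=
  \row_i (if unlift ord0 i is Some j then v 0 j else a).
Arguments cons_row {n} a v.

Lemma cons_row0 n a (v : 'rV[R]_n) : cons_row a v 0 0 = a.
Proof. by rewrite mxE unlift_none. Qed.

Lemma cons_row_lift n a (v : 'rV[R]_n) j : cons_row a v 0 (lift ord0 j) = v 0 j.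
Proof. by rewrite mxE liftK. Qed.

Lemma row_tcons n a (t : n.-tuple mR) :
  \row_i tnth (tcons (a, t)) i = cons_row a (\row_i tnth t i).
Proof.
apply/rowP => i; rewrite !mxE.
by case: unliftP => [j|] ->; rewrite ?mxE ?tnthS ?tnth0.
Qed.

Lemma cons_row_continuousl n (v : 'rV[R]_n) : continuous (cons_row ^~ v).
Proof.
move=> a; apply/cvg_ballP => e e0; near=> b; split => // i j.
rewrite !mxE; case: unliftP => [k _|_]; first exact: ballxx.
by near: b; apply: (nbhsx_ballx (a : R)); exact: e0.
Unshelve. all: by end_near. Qed.

Lemma cons_row_continuousr n (a : R) : continuous (@cons_row n a).
Proof.
move=> v; apply/(@cvg_ballP _ _ _ _ (nbhs_filter v)) => e e0.
have : \forall w \near v, ball v e w by exact: nbhsx_ballx.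
apply: (@filterS _ (nbhs v) _) => w [_ vw]; split => // i j.
by rewrite !mxE; case: unliftP => [k _|_]; [exact: vw|exact: ballxx].
Qed.

Lemma scale_delta_cons_row0 n h a (v : 'rV[R]_n) :
  h *: delta_mx 0 0 + cons_row a v = cons_row (h + a) v.
Proof.
apply/rowP => i; rewrite !mxE eqxx/=; case: unliftP => [j|] ->.
  by rewrite mulr0 add0r.
by rewrite eqxx mulr1.
Qed.

Lemma scale_delta_cons_row_lift n h a (v : 'rV[R]_n) j :
  h *: delta_mx 0 (lift ord0 j) + cons_row a v =
  cons_row a (h *: delta_mx 0 j + v).
Proof.
apply/rowP => i; rewrite !mxE eqxx/=; case: unliftP => [k|] ->; last first.
  by rewrite mulr0 add0r.
by rewrite !mxE (inj_eq lift_inj).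
Qed.

Lemma is_derive_cons_row0 n (g : 'rV[R]_n.+1 -> R) a v :
  derivable g (cons_row a v) (delta_mx 0 0) ->
  is_derive a 1 (fun b => g (cons_row b v)) (partial 0 g (cons_row a v)).
Proof.
by apply: is_derive_along => h; rewrite scale_delta_cons_row0 [h *: 1]mulr1.
Qed.

Lemma is_derive_cons_row_lift n (g : 'rV[R]_n.+1 -> R) a v j :
  derivable g (cons_row a v) (delta_mx 0 (lift ord0 j)) ->
  is_derive v (delta_mx 0 j) (fun w => g (cons_row a w))
    (partial (lift ord0 j) g (cons_row a v)).
Proof. by apply: is_derive_along => h; rewrite scale_delta_cons_row_lift. Qed.

Lemma is_derive_near0 (V : normedModType R) (g : V -> R) x v :
  (\near x, g x = 0) -> is_derive x v g 0.
Proof.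
move=> g0; have : is_derive x v (cst (0 : R)) 0 by exact: is_derive_cst.
apply: near_eq_is_derive.
by near=> y; rewrite /= (near g0 y).
Unshelve. all: by end_near. Qed.

(** The fundamental theorem of calculus on an interval at whose endpoints [f] vanishes. *)
Lemma integral_derive_eq0 (f df : R -> R) M :
  (forall x : R, is_derive x 1 f (df x)) -> continuous df ->
  (forall x : R, f x != 0 -> x \in `[- M, M]) ->
  (\int[@lebesgue_measure R]_x (df x)%:E = 0)%E.
Proof.
move=> fdf cdf fM.
have df0 x : x \notin `[- M, M] -> df x = 0.
  move=> xM; have := fdf x; case=> _ <-.
  apply/derive_val/is_derive_near0.
  have : nbhs x (~` `[- M, M]%classic).
    by apply: closed_nbhsC; [exact: itv_closed|exact/negP].
  apply: (@filterS _ (nbhs x) _) => y yM.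
  by apply/eqP; apply/negP => /negP/fM.
have cf : continuous f.
  move=> x; apply/differentiable_continuous/derivable1_diffP.
  by have [] := fdf x.
(* Strictly larger than |M|: [f] vanishes at both endpoints, and the interval is nondegenerate even
   for negative [M]. *)
pose N := `|M| + 1.
have NN : - N < N by rewrite /N; have := normr_ge0 M; lra.
have MN x : x \in `[- M, M] -> x \in `]- N, N[.
  by rewrite !in_itv/= /N; have := ler_norm M; lra.
have f0 x : x \notin `]- N, N[ -> f x = 0.
  by move=> xN; apply/eqP; apply: contraNT xN => /fM /MN.
rewrite (_ : (fun x => _) = (fun x => (df x)%:E) \_ `[- N, N]); last first.
  apply/funext => x; rewrite patchE; case: ifPn => // xN; rewrite df0//.
  apply: contra xN => /MN; rewrite inE/=; exact: subset_itv_oo_cc.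
rewrite -integral_mkcond (@continuous_FTC2 _ df f)//.
- by rewrite !f0 ?subee// in_itv/= ltxx// andbF.
- exact: continuous_subspaceT.
- split.
  + by move=> x _; have [] := fdf x.
  + exact/cvg_at_right_filter/cf.
  + exact/cvg_at_left_filter/cf.
- by move=> x _; rewrite derive1E; have [] := fdf x.
Qed.

(** The measure on tuples is the image of the product measure under [tcons], so the finite integral
    of |g| carries over; Fubini's theorem then applies. *)
Lemma integrable_tcons n (g : 'rV[R]_n.+1 -> R) :
  continuous g -> bounded_support g ->
  (@lebesgue_measure R \x lebesgue_tuple n)%E.-integrable setT
    (fun p : mR * n.-tuple mR => (g (\row_i tnth (tcons p) i))%:E).
Proof.
move=> cg bg; have /integrableP[_ ig] := integrable_row cg bg.
have mg := continuous_measurable_row cg.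
apply/integrableP; split.
  apply/measurable_EFinP.
  exact: (measurableT_comp mg (@measurable_tcons R n)).
move: ig; rewrite /= /lebesgue_cons ge0_integral_pushforward//=.
  exact: measurable_tcons.
by apply/measurable_EFinP; exact: measurableT_comp.
Qed.

Lemma integral_tcons n (g : 'rV[R]_n.+1 -> R) :
  continuous g -> bounded_support g ->
  (\int[lebesgue_tuple n.+1]_t (g (\row_i tnth t i))%:E =
   \int[@lebesgue_measure R \x lebesgue_tuple n]_p
     (g (\row_i tnth (tcons p) i))%:E)%E.
Proof.
move=> cg bg; have ig := integrable_tcons cg bg.
have mg := continuous_measurable_row cg.
rewrite /= /lebesgue_cons (integral_pushforward (@measurable_tcons R n)) //.
exact/measurable_EFinP.
Qed.

Lemma nbhs_coord n (x : 'rV[R]_n) i M : x 0 i \notin `[- M, M] ->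
  \forall y \near x, (y : 'rV[R]_n) 0 i \notin `[- M, M].
Proof.
move=> xM; have := @coord_continuous R 1 n 0 i x (~` `[- M, M]%classic).
have oM : nbhs (x 0 i) (~` `[- M, M]%classic).
  by apply: closed_nbhsC; [exact: itv_closed|exact/negP].
move=> /(_ oM); apply: (@filterS _ (nbhs x) _) => y /= yM; exact/negP.
Qed.

Lemma bounded_support_partial n j (g : 'rV[R]_n -> R) : bounded_support g ->
  bounded_support (partial j g).
Proof.
move=> [M gM]; exists M => x pg i; apply: contraNT pg => /nbhs_coord xM.
apply/eqP/derive_val/is_derive_near0.
apply: (@filterS _ (nbhs x) _ _ _ _ xM) => y yM.
by apply/eqP; apply: contraNT yM => /gM.
Qed.

(** Induction on the dimension. Fubini's theorem allows the inner integral to be taken over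
    variables that include the [j]-th one, and that inner integral is already zero. *)
Lemma integral_partial_eq0 n j (g : 'rV[R]_n -> R) :
  (forall x, derivable g x (delta_mx 0 j)) -> continuous (partial j g) ->
  bounded_support g ->
  (\int[lebesgue_tuple n]_t (partial j g (\row_i tnth t i))%:E = 0)%E.
Proof.
elim: n j g => [[]//|n IH] j g dg cg bg.
have bpg := bounded_support_partial j bg.
have ig := integrable_tcons cg bpg.
have [M gM] := bg.
rewrite integral_tcons//; case: (unliftP ord0 j) => [k|] jE; subst j.
  (* The direction is not the first one: freeze the first coordinate and use the induction
     hypothesis on the slice. *)
  rewrite -integral12_prod_meas1//; apply: integral0_eq => a _.
  rewrite /fubini_F; under eq_integral do rewrite row_tcons.
  have dga v := is_derive_cons_row_lift (dg (cons_row a v)).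
  have E : partial k (fun v => g (cons_row a v)) =
           (fun v => partial (lift ord0 k) g (cons_row a v)).
    by apply/funext => v; exact: derive_val.
  have := IH k (fun v => g (cons_row a v)); rewrite E; apply.
  - by move=> v; have [] := dga v.
  - move=> v; apply: continuous_comp; last exact: cg.
    exact: cons_row_continuousr.
  - by exists M => v /gM H i; have := H (lift ord0 i); rewrite cons_row_lift.
(* The direction is the first one: freeze the others and use the one-dimensional case. *)
rewrite -integral21_prod_meas1//; apply: integral0_eq => t _.
rewrite /fubini_G; under eq_integral do rewrite row_tcons.
set v := \row_i tnth t i.
apply: (@integral_derive_eq0 (fun a => g (cons_row a v))
  (fun a => partial ord0 g (cons_row a v)) M).
- by move=> a; exact/is_derive_cons_row0.
- move=> a; apply: (@continuous_comp _ _ _ (cons_row ^~ v) (partial ord0 g)).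
    exact: cons_row_continuousl.
  exact: cg.
- by move=> a /gM /(_ ord0); rewrite cons_row0.
Qed.

End integration.

(** * Equality of mixed second derivatives *)

Section symmetry_of_second_derivatives.
Context {R : realType} {V : normedModType R}.
Implicit Types (g : V -> R) (u v x y : V).

Lemma is_derive_translation g c x u : derivable g (c + x) u ->
  is_derive x u (fun z => g (c + z)) ('D_u g (c + x)).
Proof. by apply: is_derive_along => h; rewrite addrCA. Qed.

Lemma is_derive_line g u y (s : R) : derivable g (s *: u + y) u ->
  is_derive s 1 (fun a => g (a *: u + y)) ('D_u g (s *: u + y)).
Proof.
by apply: is_derive_along => h; rewrite scalerDl [h *: 1]mulr1 addrA.
Qed.

Lemma MVT_line g u y (h : R) : 0 < h -> (forall z, derivable g z u) ->
  exists2 s, s \in `]0, h[ & g (h *: u + y) - g y = h * 'D_u g (s *: u + y).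
Proof.
move=> h0 dg; have dl s := is_derive_line (dg (s *: u + y)).
have [|s sh E] := @MVT R (fun a => g (a *: u + y)) _ 0 h h0 (fun s _ => dl s).
  apply: continuous_subspaceT => s.
  apply/differentiable_continuous/derivable1_diffP.
  by have [] := dl s.
by exists s => //; move: E; rewrite scale0r add0r subr0 mulrC.
Qed.

(** The mean value theorem is used twice: along [u] for the increment of [g] by [h *: v], then along
    [v] for ['D_u g]. *)
Lemma second_difference g u v x (h : R) : 0 < h ->
  (forall z, derivable g z u) -> (forall z, derivable ('D_u g) z v) ->
  exists s t, [/\ s \in `]0, h[, t \in `]0, h[ &
    (g (h *: v + (h *: u + x)) - g (h *: u + x)) - (g (h *: v + x) - g x)
    = h * (h * 'D_v ('D_u g) (t *: v + (s *: u + x)))].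
Proof.
move=> h0 dg ddg.
have dG z : is_derive z u (fun z => g (h *: v + z) - g z)
    ('D_u g (h *: v + z) - 'D_u g z).
  apply: is_deriveB; first exact: is_derive_translation.
  exact: derivableP.
have [|s sh ->] := @MVT_line (fun z => g (h *: v + z) - g z) u x h h0.
  by move=> z; have [] := dG z.
have [t th E] := @MVT_line ('D_u g) v (s *: u + x) h h0 ddg.
exists s, t; split => //; congr (_ * _).
by rewrite -E; exact: derive_val.
Qed.

(** The second difference is symmetric in [u] and [v], so the two mixed derivatives agree at some
    pair of points arbitrarily close to [x]; continuity at [x] concludes. *)
Lemma derive_comm g u v x :
  (forall z, derivable g z u) -> (forall z, derivable g z v) ->
  (forall z, derivable ('D_u g) z v) -> (forall z, derivable ('D_v g) z u) ->
  {for x, continuous ('D_v ('D_u g))} -> {for x, continuous ('D_u ('D_v g))} ->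
  'D_v ('D_u g) x = 'D_u ('D_v g) x.
Proof.
move=> du dv duv dvu cuv cvu; apply/eqP; rewrite -subr_eq0 -normr_le0.
apply/ler_addgt0Pl => e e0; rewrite addr0.
have e20 : 0 < e / 2 by rewrite divr_gt0.
have [d d0 dP] : exists2 d : R, 0 < d & forall z, `|z| < d ->
    `|'D_v ('D_u g) x - 'D_v ('D_u g) (z + x)| < e / 2 /\
    `|'D_u ('D_v g) x - 'D_u ('D_v g) (z + x)| < e / 2.
  have /cvgrPdist_lt/(_ _ e20) cuv' := cuv.
  have /cvgrPdist_lt/(_ _ e20) cvu' := cvu.
  have /nbhs_ballP[d /= d0 dP] : \forall y \near x,
      `|'D_v ('D_u g) x - 'D_v ('D_u g) y| < e / 2 /\
      `|'D_u ('D_v g) x - 'D_u ('D_v g) y| < e / 2.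
    by apply: filterI; [exact: cuv'|exact: cvu'].
  exists d => // z zd; apply: dP.
  by rewrite -ball_normE/= opprD addrCA subrr addr0 normrN.
(* Keeps all intermediate points within [d] of [x]; the summand 1 keeps the denominator positive
   when [u] and [v] are zero. *)
pose h := d / (`|u| + `|v| + 1).
have h0 : 0 < h by rewrite divr_gt0// ltr_wpDl// addr_ge0.
have hd (s t : R) : s \in `]0, h[ -> t \in `]0, h[ -> `|t *: v + s *: u| < d.
  rewrite !in_itv/= => /andP[s0 sh] /andP[t0 th].
  rewrite (le_lt_trans (ler_normD _ _))// !normrZ !gtr0_norm//.
  rewrite (@le_lt_trans _ _ (h * (`|u| + `|v|)))//.
    by rewrite mulrDr addrC lerD// ler_wpM2r// ltW.
  by rewrite /h mulrAC ltr_pdivrMr ?ltr_pM2l ?ltrDl// ltr_wpDl// addr_ge0.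
have [s [t [sh th E]]] := second_difference x h0 du duv.
have [s' [t' [sh' th' E']]] := second_difference x h0 dv dvu.
have {E E'} DE : 'D_v ('D_u g) (t *: v + s *: u + x) =
    'D_u ('D_v g) (s' *: v + t' *: u + x).
  have hn : h != 0 by rewrite gt_eqF.
  apply/(mulfI hn)/(mulfI hn); rewrite -!addrA -E [s' *: v + _]addrCA -E'.
  rewrite [h *: u + (h *: v + x)]addrCA.
  rewrite -!addrA; congr (_ + _).
  by rewrite !opprB addrCA [RHS]addrCA [in RHS](addrC (- _)).
have [H _] := dP _ (hd _ _ sh th).
have [_ H'] := dP _ (hd _ _ th' sh').
rewrite DE in H.
apply: (le_trans (ler_distD ('D_u ('D_v g) (s' *: v + t' *: u + x)) _ _)).
rewrite [leRHS]splitr; apply: lerD; first exact: ltW H.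
by rewrite distrC; exact: ltW H'.
Qed.

End symmetry_of_second_derivatives.

(** * Derivatives and continuity of coordinates and powers of the norm *)

Section calculus.
Context {R : realType} {n : nat}.
Implicit Types (f g : 'rV[R]_n -> R) (x v : 'rV[R]_n) (K : set 'rV[R]_n).

Lemma is_derive_mul f g x v df dg : is_derive x v f df -> is_derive x v g dg ->
  is_derive x v (fun y => f y * g y) (df * g x + f x * dg).
Proof.
move=> Hf Hg; have := is_deriveM Hf Hg.
by move=> H; apply: is_derive_eq; rewrite addrC [g x *: _]mulrC.
Qed.

Lemma is_derive_sumr (F : 'I_n -> 'rV[R]_n -> R) x v (dF : 'I_n -> R) :
  (forall i, is_derive x v (F i) (dF i)) ->
  is_derive x v (fun y => \sum_i F i y) (\sum_i dF i).
Proof.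
move=> HF; have -> : (fun y => \sum_i F i y) = \sum_i F i.
  by apply/funext => y; rewrite fct_sumE.
exact: is_derive_sum.
Qed.

Lemma is_derive_coord j k x :
  is_derive x (delta_mx 0 j) (fun y => y 0 k) (j == k)%:R.
Proof.
have E : (fun h : R => h^-1 *: (((fun y : 'rV[R]_n => y 0 k) \o shift x)
    (h *: delta_mx 0 j) - x 0 k)) @ 0^' --> ((j == k)%:R : R).
  apply: cvg_near_cst; near=> h.
  rewrite /= !mxE addrK eqxx/= eq_sym -[_ *: _]/(_ * _) mulrA mulVf ?mul1r//.
  by near: h; exact: nbhs_dnbhs_neq.
apply: DeriveDef; first exact: (cvgP _ E).
exact: (cvg_lim _ E).
Unshelve. all: by end_near. Qed.

Definition sqnorm x := \sum_i x 0 i ^+ 2.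

Lemma sqnorm_eq0 x : (sqnorm x == 0) = (x == 0).
Proof.
rewrite psumr_eq0 => [|i _]; last exact: sqr_ge0.
apply/allP/eqP => [x0|-> i _]; last by rewrite /= mxE expr0n.
apply/rowP => i; rewrite mxE; apply/eqP.
by have := x0 i; rewrite mem_index_enum sqrf_eq0; apply.
Qed.

Lemma is_derive_sqnorm j x : is_derive x (delta_mx 0 j) sqnorm (2 * x 0 j).
Proof.
have -> : sqnorm = fun y => \sum_i (y 0 i * y 0 i) by [].
apply: is_derive_eq.
  apply: is_derive_sumr => i.
  exact: is_derive_mul (is_derive_coord j i x) (is_derive_coord j i x).
rewrite (bigD1 j)//= big1 ?addr0 => [|i ij].
  by rewrite eqxx mul1r mulr1 -mulr2n mulr_natl.
by rewrite eq_sym (negPf ij) mul0r mulr0 addr0.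
Qed.

Lemma is_derive_sqnormV j x : x != 0 ->
  is_derive x (delta_mx 0 j) (fun y => (sqnorm y)^-1)
    (- 2 * x 0 j * (sqnorm x)^-1 ^+ 2).
Proof.
rewrite -sqnorm_eq0 => x0; have [dx dE] := is_derive_sqnorm j x.
apply: DeriveDef; first exact: derivableV.
by rewrite deriveV// dE -[_ *: _]/(_ * _) exprVn; ring.
Qed.

Lemma continuous_sumr (F : 'I_n -> 'rV[R]_n -> R) x :
  (forall i, {for x, continuous (F i)}) ->
  {for x, continuous (fun y => \sum_i F i y)}.
Proof.
move=> Fc.
apply: (@cvg_big _ _ +%R 0 xpredT add_continuous _ (nbhs x) _ F _
  (nbhs_filter x)) => i _.
exact: Fc.
Qed.

Lemma continuous_sqnormV x :
  x != 0 -> {for x, continuous (fun y => (sqnorm y)^-1)}.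
Proof.
move=> x0; apply: continuousV; first by rewrite sqnorm_eq0.
apply: continuous_sumr => i.
by apply: continuousM; exact: coord_continuous.
Qed.

(** * Functions supported in a compact set away from the origin, and their integrals *)

Lemma is_derive_partial0 K j g : closed K -> (forall x, ~ K x -> g x = 0) ->
  forall x, ~ K x -> is_derive x (delta_mx 0 j) g 0.
Proof.
move=> cK g0 x Kx; apply: is_derive_near0.
have : nbhs x (~` K) by exact: closed_nbhsC.
by apply: (@filterS _ (nbhs x) _) => y; exact: g0.
Qed.

(* Continuity at 0 comes for free, K being a closed set away from 0. *)
Definition admissible K g :=
  (forall x, ~ K x -> g x = 0) /\ (forall x, x != 0 -> {for x, continuous g}).

Lemma admissible_continuous K g :
  closed K -> ~ K 0 -> admissible K g -> continuous g.
Proof.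
move=> cK K0 [g0 gc] x; have [->|] := eqVneq x 0; last exact: gc.
apply: (near_cst_continuous 0).
have : nbhs (0 : 'rV[R]_n) (~` K) by exact: closed_nbhsC.
by apply: (@filterS _ (nbhs (0 : 'rV[R]_n)) _) => y; exact: g0.
Qed.

Lemma compact_bounded_support K g : compact K -> (forall x, ~ K x -> g x = 0) ->
  bounded_support g.
Proof.
move=> cK g0; have /compact_bounded[M [Mr MK]] := cK.
(* [compact_bounded] gives a bound for each constant strictly above [M]. The norm is the sup norm,
   so it bounds every coordinate. *)
exists (M + 1) => x gx i.
have Kx : K x by apply: contrapT => /g0 /eqP; rewrite (negPf gx).
have := MK (M + 1); rewrite ltrDl ltr01 => /(_ isT x Kx) xM.
suff : `|x 0 i : R| <= M + 1 by rewrite ler_norml in_itv.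
apply: le_trans xM; rewrite [leRHS]/Num.Def.normr/= mx_normrE.
by apply/bigmax_geP; right; exists (0, i).
Qed.

Section support.
Variable K : set 'rV[R]_n.
Hypotheses (cK : compact K) (K0 : ~ K 0).

Let closedK : closed K.
Proof. exact: compact_closed (@norm_hausdorff _ _) cK. Qed.

Lemma admissible_add f g : admissible K f -> admissible K g ->
  admissible K (fun x => f x + g x).
Proof.
move=> [f0 fc] [g0 gc]; split => x H; first by rewrite f0// g0// addr0.
by apply: continuousD; [exact: fc|exact: gc].
Qed.

Lemma admissible_mull f g : (forall x, x != 0 -> {for x, continuous f}) ->
  admissible K g -> admissible K (fun x => f x * g x).
Proof.
move=> fc [g0 gc]; split => x H; first by rewrite g0// mulr0.
by apply: continuousM; [exact: fc|exact: gc].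
Qed.

Lemma admissible_scale a g : admissible K g -> admissible K (fun x => a * g x).
Proof.
by apply: (@admissible_mull (fun=> a)) => x _; exact: cst_continuous.
Qed.

Lemma admissible_sum (F : 'I_n -> 'rV[R]_n -> R) :
  (forall i, admissible K (F i)) -> admissible K (fun x => \sum_i F i x).
Proof.
move=> HF; split => x H; first by apply: big1 => i _; apply: (HF i).1.
by apply: continuous_sumr => i; exact: (HF i).2.
Qed.

Lemma admissible_integrable g : admissible K g ->
  (lebesgue_tuple n).-integrable setT (fun t => (g (\row_i tnth t i))%:E).
Proof.
move=> ag; apply: integrable_row; first exact: admissible_continuous ag.
exact: compact_bounded_support cK ag.1.
Qed.

Lemma integral_RnD f g : admissible K f -> admissible K g ->
  integral_Rn (fun x => f x + g x) = integral_Rn f + integral_Rn g.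
Proof.
move=> /admissible_integrable fi /admissible_integrable gi.
exact: RintegralD.
Qed.

Lemma integral_RnZ a g : admissible K g ->
  integral_Rn (fun x => a * g x) = a * integral_Rn g.
Proof. by move=> /admissible_integrable gi; exact: RintegralZl. Qed.

Lemma le_integral_Rn f g : admissible K f -> admissible K g ->
  (forall x, f x <= g x) -> integral_Rn f <= integral_Rn g.
Proof.
move=> /admissible_integrable fi /admissible_integrable gi fg.
exact: le_Rintegral.
Qed.

(** The divergence theorem without boundary term. Derivatives are asked for only off the origin,
    where the weights are smooth; near the origin the field is zero. *)
Lemma integral_divergence_eq0 (F dF : 'I_n -> 'rV[R]_n -> R) :
  (forall j x, ~ K x -> F j x = 0) -> (forall j, admissible K (dF j)) ->
  (forall j x, x != 0 -> is_derive x (delta_mx 0 j) (F j) (dF j x)) ->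
  integral_Rn (fun x => \sum_j dF j x) = 0.
Proof.
move=> F0 adF FdF.
have dFj j x : is_derive x (delta_mx 0 j) (F j) (dF j x).
  have [->|/FdF//] := eqVneq x 0.
  by rewrite (adF j).1//; exact: is_derive_partial0 (F0 j) _ K0.
have pE j : partial j (F j) = dF j by apply/funext => x; exact: derive_val.
rewrite /integral_Rn /Rintegral.
under eq_integral do rewrite -sumEFin.
rewrite integral_sum//; last by move=> j; exact: admissible_integrable.
rewrite big1// => j _; rewrite -pE; apply: integral_partial_eq0.
- by move=> x; have [] := dFj j x.
- rewrite pE; exact: admissible_continuous (adF j).
- exact: compact_bounded_support cK (F0 j).
Qed.

End support.

End calculus.

(** * Differential expressions in a real test function *)

Section rellich.
Context {R : realType} {n : nat}.
Variables (K : set 'rV[R]_n) (u : 'rV[R]_n -> R).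
Hypotheses (cK : compact K) (K0 : ~ K 0).
Hypotheses (us : smooth u) (u0 : forall x, ~ K x -> u x = 0).

Local Notation d j := (partial j u).
Local Notation dd j k := (partial j (partial k u)).
Local Notation w x := (sqnorm x)^-1.

Definition euler (x : 'rV[R]_n) := \sum_k x 0 k * d k x.
Definition grad2 (x : 'rV[R]_n) := \sum_k d k x ^+ 2.
Definition lapl (x : 'rV[R]_n) := \sum_k dd k k x.

Let closedK : closed K.
Proof. exact: compact_closed (@norm_hausdorff _ _) cK. Qed.

Let d0 j x : ~ K x -> d j x = 0.
Proof. by move=> Kx; have [] := is_derive_partial0 j closedK u0 Kx. Qed.

Let dd0 j k x : ~ K x -> dd j k x = 0.
Proof. by move=> Kx; have [] := is_derive_partial0 j closedK (d0 k) Kx. Qed.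

Let uD j x : is_derive x (delta_mx 0 j) u (d j x).
Proof. by apply: derivableP; have [_] := us [::]; apply. Qed.

Let dD j k x : is_derive x (delta_mx 0 j) (d k) (dd j k x).
Proof. by apply: derivableP; have [_] := us [:: k]; apply. Qed.

Lemma partial_comm j k (x : 'rV[R]_n) : dd j k x = dd k j x.
Proof.
apply: derive_comm => [z|z|z|z||].
- by have [] := uD k z.
- by have [] := uD j z.
- by have [] := dD j k z.
- by have [] := dD k j z.
- by have [c _] := us [:: j; k]; exact: c.
- by have [c _] := us [:: k; j]; exact: c.
Qed.

Let aK_u : admissible K u.
Proof. by split => // x _; have [c _] := us [::]; exact: c. Qed.

Let aK_d j : admissible K (d j).
Proof. by split => [x|x _]; [exact: d0|have [c _] := us [:: j]; exact: c]. Qed.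

Let aK_dd j k : admissible K (dd j k).
Proof.
by split => [x|x _]; [exact: dd0|have [c _] := us [:: j; k]; exact: c].
Qed.

Let aK_euler : admissible K euler.
Proof.
apply: admissible_sum => k; apply: admissible_mull => // x _.
exact: coord_continuous.
Qed.

Let aK_sqr g : admissible K g -> admissible K (fun x => g x ^+ 2).
Proof. by move=> ag; apply: admissible_mull => //; exact: ag.2. Qed.

Let aK_grad2 : admissible K grad2.
Proof. by apply: admissible_sum => k; exact: aK_sqr. Qed.

Let aK_lapl : admissible K lapl.
Proof. exact: admissible_sum. Qed.

Let aK_w g : admissible K g -> admissible K (fun x => w x * g x).
Proof. by apply: admissible_mull => x; exact: continuous_sqnormV. Qed.

Let aK_w2 g : admissible K g -> admissible K (fun x => w x ^+ 2 * g x).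
Proof.
apply: admissible_mull => x x0.
by apply: continuousM; exact: continuous_sqnormV.
Qed.

Lemma admissible_lapl_sqr : admissible K (fun x => lapl x ^+ 2).
Proof. exact: aK_sqr. Qed.

Lemma admissible_grad2 : admissible K (fun x => w x * grad2 x).
Proof. exact: aK_w. Qed.

Lemma admissible_euler_sqr : admissible K (fun x => w x ^+ 2 * euler x ^+ 2).
Proof. exact/aK_w2/aK_sqr. Qed.

Lemma admissible_sqr : admissible K (fun x => w x ^+ 2 * u x ^+ 2).
Proof. exact/aK_w2/aK_sqr. Qed.

Lemma is_derive_euler j (x : 'rV[R]_n) :
  is_derive x (delta_mx 0 j) euler (d j x + \sum_k x 0 k * dd j k x).
Proof.
apply: is_derive_eq.
  apply: is_derive_sumr => k.
  exact: is_derive_mul (is_derive_coord j k x) (dD j k x).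
rewrite big_split/=; congr (_ + _).
rewrite (bigD1 j)//= big1 ?addr0 => [|i ij]; first by rewrite eqxx mul1r.
by rewrite eq_sym (negPf ij) mul0r.
Qed.

Lemma is_derive_grad2 j (x : 'rV[R]_n) :
  is_derive x (delta_mx 0 j) grad2 (2 * \sum_k d k x * dd j k x).
Proof.
apply: is_derive_eq.
  apply: is_derive_sumr => k.
  exact: is_derive_mul (dD j k x) (dD j k x).
rewrite mulr_sumr; apply: eq_bigr => k _.
by rewrite mulr_natl mulr2n [dd j k x * _]mulrC.
Qed.

(** * The vector field and its divergence *)

Variables (alpha beta : R).
(** The root of 2 gamma - 4 beta + 2 alpha beta = 0, whose left side is the coefficient of w^2 u E
    in T^2 + div F. *)
Let gamma := beta * (2 - alpha).

(* Each term is chosen so that its divergence trades one cross product of the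
   expansion of T^2 (namely D w E, D w u and w^2 u E) for squares. *)
Definition rellich_field j (x : 'rV[R]_n) :=
  2 * alpha * (d j x * (w x * euler x)) - alpha * (x 0 j * (w x * grad2 x))
  + 2 * beta * (d j x * (w x * u x)) + gamma * (x 0 j * (w x ^+ 2 * u x ^+ 2)).

(* The terms of the j-th partial derivative, grouped by their dependence on j so
   that the sum over j can be read off. *)
Definition rellich_field' j (x : 'rV[R]_n) :=
  dd j j x * (2 * alpha * (w x * euler x) + 2 * beta * (w x * u x))
  + x 0 j * d j x * (- 4 * alpha * (w x ^+ 2 * euler x)
      - 4 * beta * (w x ^+ 2 * u x) + 2 * gamma * (w x ^+ 2 * u x))
  + d j x ^+ 2 * (2 * (alpha + beta) * w x)
  + d j x * (\sum_k x 0 k * dd j k x) * (2 * alpha * w x)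
  - x 0 j * (\sum_k d k x * dd j k x) * (2 * alpha * w x)
  + (- alpha * (w x * grad2 x) + gamma * (w x ^+ 2 * u x ^+ 2))
  + x 0 j ^+ 2 * (2 * alpha * (w x ^+ 2 * grad2 x)
      - 4 * gamma * (w x ^+ 3 * u x ^+ 2)).

Lemma is_derive_rellich_field j (x : 'rV[R]_n) : x != 0 ->
  is_derive x (delta_mx 0 j) (rellich_field j) (rellich_field' j x).
Proof.
move=> x0; have Dw := is_derive_sqnormV j x0.
have Dx : is_derive x (delta_mx 0 j) (fun y => y 0 j) (1 : R).
  by have := is_derive_coord j j x; rewrite eqxx.
have Dc c : is_derive x (delta_mx 0 j) (fun=> c : R) 0 by exact: is_derive_cst.
have De := is_derive_euler j x; have Dg := is_derive_grad2 j x.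
have Du := uD j x; have Dd := dD j j x.
have D1 := is_derive_mul (Dc (2 * alpha))
  (is_derive_mul Dd (is_derive_mul Dw De)).
have D2 := is_derive_mul (Dc alpha) (is_derive_mul Dx (is_derive_mul Dw Dg)).
have D3 := is_derive_mul (Dc (2 * beta))
  (is_derive_mul Dd (is_derive_mul Dw Du)).
have D4 := is_derive_mul (Dc gamma) (is_derive_mul Dx
  (is_derive_mul (is_derive_mul Dw Dw) (is_derive_mul Du Du))).
have H : is_derive x (delta_mx 0 j) (rellich_field j) _ :=
  is_deriveD (is_deriveD (is_deriveB D1 D2) D3) D4.
apply: (is_derive_eq H); rewrite /rellich_field'.
set S1 := \sum_k _; set S2 := \sum_k _.
(* With all analytic quantities made variables, a polynomial identity is left. *)
move: (w x) (euler x) (grad2 x) (u x) (d j x) (dd j j x) (x 0 j) S1 S2.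
by move=> a b c e f g h k l; ring.
Qed.

(** The expansion of the square, solved for div F. Its last summand is - T^2. *)
Lemma sum_rellich_field' (x : 'rV[R]_n) : x != 0 ->
  \sum_j rellich_field' j x = lapl x ^+ 2
    - ((n%:R - 4) * alpha - 2 * beta) * (w x * grad2 x)
    + alpha * (alpha - 4) * (w x ^+ 2 * euler x ^+ 2)
    - beta * ((n%:R - 4) * (alpha - 2) - beta) * (w x ^+ 2 * u x ^+ 2)
    - (- lapl x + alpha * (w x * euler x) + beta * (w x * u x)) ^+ 2.
Proof.
move=> x0; have ws : w x * sqnorm x = 1 by rewrite mulVf// sqnorm_eq0.
(* Symmetry of the Hessian: the second-order terms from w E grad u and from w G x then cancel. *)
have S12 : \sum_j d j x * (\sum_k x 0 k * dd j k x) =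
           \sum_j x 0 j * (\sum_k d k x * dd j k x).
  under eq_bigr do rewrite mulr_sumr.
  under [RHS]eq_bigr do rewrite mulr_sumr.
  rewrite exchange_big; apply: eq_bigr => j _; apply: eq_bigr => k _.
  by rewrite partial_comm mulrCA.
(* The sixth summand does not depend on [j]; summing it produces the dimension [n]. *)
have lin (p1 p2 p3 p4 p5 p7 : 'I_n -> R) c1 c2 c3 c4 c5 c6 c7 :
    \sum_j (p1 j * c1 + p2 j * c2 + p3 j * c3 + p4 j * c4 - p5 j * c5 + c6
            + p7 j * c7)
    = (\sum_j p1 j) * c1 + (\sum_j p2 j) * c2 + (\sum_j p3 j) * c3
      + (\sum_j p4 j) * c4 - (\sum_j p5 j) * c5 + n%:R * c6
      + (\sum_j p7 j) * c7.
  by rewrite !big_split/= sumrN !mulr_suml sumr_const card_ord mulr_natl.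
rewrite /rellich_field' lin S12 -/(euler x) -/(grad2 x) -/(lapl x) -/(sqnorm x).
set S := \sum_j x 0 j * _; rewrite /gamma; move: (n%:R : R) => m.
move: (w x) ws => a as1.
move: (sqnorm x) as1 (euler x) (grad2 x) (u x) (lapl x) S => s as1 b c e f g.
(* Exposes the factor w |x|^2, which equals 1. *)
have -> : s * (2 * alpha * (a ^+ 2 * c)
      - 4 * (beta * (2 - alpha)) * (a ^+ 3 * e ^+ 2)) =
    (a * s) * (2 * alpha * (a * c)
      - 4 * (beta * (2 - alpha)) * (a ^+ 2 * e ^+ 2)) by ring.
by rewrite as1; ring.
Qed.

Let aK_rellich_field' j : admissible K (rellich_field' j).
Proof.
split=> [x Kx|x x0].
  rewrite /rellich_field' [\sum_k d k x * _]big1 => [|k _]; last first.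
    by rewrite d0// mul0r.
  rewrite d0// dd0// u0// aK_grad2.1// aK_euler.1//.
  ring.
have cw := continuous_sqnormV x0.
have cx i : {for x, continuous (fun y : 'rV[R]_n => y 0 i)}.
  exact: coord_continuous.
have [[cu ce] cg] := (aK_u.2 x x0, aK_euler.2 x x0, aK_grad2.2 x x0).
have cd i := (aK_d i).2 x x0; have cdd i k := (aK_dd i k).2 x x0.
have cc (c : R) : {for x, continuous (fun=> c)} by exact: cst_continuous.
have cX (f : 'rV[R]_n -> R) (m : nat) :
    {for x, continuous f} -> {for x, continuous (fun y => f y ^+ m)}.
  move=> cf; apply: (@continuous_comp _ _ _ f (fun z : R => z ^+ m)) => //.
  exact: exprn_continuous.
have cD (f g : 'rV[R]_n -> R) :
  {for x, continuous f} -> {for x, continuous g} ->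
  {for x, continuous (fun y => f y + g y)} by exact: continuousD.
have cM (f g : 'rV[R]_n -> R) :
  {for x, continuous f} -> {for x, continuous g} ->
  {for x, continuous (fun y => f y * g y)} by exact: continuousM.
have cN (f : 'rV[R]_n -> R) : {for x, continuous f} ->
  {for x, continuous (fun y => - f y)} by exact: continuousN.
have cM3 a (f g : 'rV[R]_n -> R) (cf : {for x, continuous f})
    (cg' : {for x, continuous g}) :
  {for x, continuous (fun y => a * (f y * g y))} :=
  cM _ _ (cc a) (cM _ _ cf cg').
(* [t1] to [t7] follow the seven summands of [rellich_field'] in order. *)
have t1 := cM _ _ (cdd j j)
  (cD _ _ (cM3 (2 * alpha) _ _ cw ce) (cM3 (2 * beta) _ _ cw cu)).
have t2 := cM _ _ (cM _ _ (cx j) (cd j))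
  (cD _ _ (cD _ _ (cM3 (- 4 * alpha) _ _ (cX _ 2 cw) ce)
                  (cN _ (cM3 (4 * beta) _ _ (cX _ 2 cw) cu)))
          (cM3 (2 * gamma) _ _ (cX _ 2 cw) cu)).
have t3 := cM _ _ (cX _ 2 (cd j)) (cM _ _ (cc (2 * (alpha + beta))) cw).
have t4 := cM _ _ (cM _ _ (cd j)
    (continuous_sumr (fun k => cM _ _ (cx k) (cdd j k))))
  (cM _ _ (cc (2 * alpha)) cw).
have t5 := cM _ _ (cM _ _ (cx j)
    (continuous_sumr (fun k => cM _ _ (cd k) (cdd j k))))
  (cM _ _ (cc (2 * alpha)) cw).
have t6 := cD _ _ (cM3 (- alpha) _ _ cw cg)
  (cM3 gamma _ _ (cX _ 2 cw) (cX _ 2 cu)).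
have t7 := cM _ _ (cX _ 2 (cx j)) (cD _ _ (cM3 (2 * alpha) _ _ (cX _ 2 cw) cg)
   (cN _ (cM3 (4 * gamma) _ _ (cX _ 3 cw) (cX _ 2 cu)))).
have t14 := cD _ _ (cD _ _ (cD _ _ t1 t2) t3) t4.
exact: (cD _ _ (cD _ _ (cD _ _ t14 (cN _ t5)) t6) t7).
Qed.

(** * The inequalities for real functions *)

Lemma rellich_real :
  ((n%:R - 4) * alpha - 2 * beta) * integral_Rn (fun x => w x * grad2 x)
  - alpha * (alpha - 4) * integral_Rn (fun x => w x ^+ 2 * euler x ^+ 2)
  + beta * ((n%:R - 4) * (alpha - 2) - beta)
    * integral_Rn (fun x => w x ^+ 2 * u x ^+ 2)
  <= integral_Rn (fun x => lapl x ^+ 2).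
Proof.
have [aD aG aE aU] := And4 admissible_lapl_sqr admissible_grad2
  admissible_euler_sqr admissible_sqr.
have aF := admissible_sum aK_rellich_field'.
have div0 : integral_Rn (fun x => \sum_j rellich_field' j x) = 0.
  apply: (integral_divergence_eq0 cK K0 _ aK_rellich_field'
    is_derive_rellich_field) => j x Kx.
  by rewrite /rellich_field d0// u0// aK_grad2.1//; ring.
set a := _ - 2 * beta; set b := alpha * _; set c := beta * _.
have aG' := admissible_scale a aG; have aE' := admissible_scale (- b) aE.
have aU' := admissible_scale c aU; have aGE := admissible_add aG' aE'.
have aS := admissible_add aGE aU'.
rewrite -mulNr -!(integral_RnZ cK K0)// -!(integral_RnD cK K0)//.
(* Adding the zero integral of div F reduces the claim to a pointwise one: the integrands now differ
   by T^2. *)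
rewrite -[leLHS]addr0 -div0 -(integral_RnD cK K0)//.
apply: (le_integral_Rn cK K0) => //; first exact: admissible_add.
(* The identity for div F holds off the origin only; at the origin, which is outside [K], the left
   side is 0. *)
move=> x; have [->|x0] := eqVneq x 0.
  by rewrite aS.1// aF.1// addr0 sqr_ge0.
rewrite sum_rellich_field'// -/a -/b -/c -[leRHS]addr0 -subr_ge0.
set T := (- lapl x + _ + _) ^+ 2.
rewrite (_ : _ - _ = T) ?sqr_ge0//; ring.
Qed.

(** Pointwise this is the Cauchy-Schwarz inequality E^2 <= |x|^2 G. *)
Lemma le_integral_euler :
  integral_Rn (fun x => w x ^+ 2 * euler x ^+ 2)
  <= integral_Rn (fun x => w x * grad2 x).
Proof.
apply: (le_integral_Rn cK K0 admissible_euler_sqr admissible_grad2) => x.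
have [->|x0] := eqVneq x 0.
  by rewrite admissible_euler_sqr.1// admissible_grad2.1.
have s0 : 0 < sqnorm x.
  by rewrite lt_neqAle eq_sym sqnorm_eq0 x0 sumr_ge0// => i _; exact: sqr_ge0.
rewrite expr2 -mulrA ler_pM2l ?invr_gt0// ler_pdivrMl//.
(* After one more factor |x|^2 the difference of the two sides is the squared norm of |x|^2 grad u -
   E x. *)
rewrite -(ler_pM2l s0) -subr_ge0.
have : 0 <= \sum_k (sqnorm x * d k x - euler x * x 0 k) ^+ 2.
  by apply: sumr_ge0 => k _; exact: sqr_ge0.
rewrite (_ : \sum_k _ = \sum_k (sqnorm x ^+ 2 * d k x ^+ 2
    - 2 * sqnorm x * euler x * (x 0 k * d k x)
    + euler x ^+ 2 * x 0 k ^+ 2)); last first.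
  by apply: eq_bigr => k _; ring.
rewrite !big_split/= sumrN -!mulr_sumr -/(grad2 x) -/(euler x) -/(sqnorm x).
by congr (0 <= _); ring.
Qed.

End rellich.

(** * From real to complex functions *)

(** The suffixes [a] and [b] stand for the integrals of the real and imaginary parts. In the second
    claim alpha (alpha - 4) >= 0 lets E be replaced by G, and (m - 4) alpha - alpha (alpha - 4) =
    alpha (m - alpha). *)
Lemma rellich_combine (R : realFieldType)
    (alpha beta m c Ga Gb Ea Eb Ua Ub Da Db : R) :
  ((m - 4) * alpha - 2 * beta) * Ga - alpha * (alpha - 4) * Ea + c * Ua <= Da ->
  ((m - 4) * alpha - 2 * beta) * Gb - alpha * (alpha - 4) * Eb + c * Ub <= Db ->
  Ea <= Ga -> Eb <= Gb ->
  ((m - 4) * alpha - 2 * beta) * (Ga + Gb) - alpha * (alpha - 4) * (Ea + Eb)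
    + c * (Ua + Ub) <= Da + Db
  /\ (alpha <= 0 \/ 4 <= alpha ->
      (alpha * (m - alpha) - 2 * beta) * (Ga + Gb) + c * (Ua + Ub) <= Da + Db).
Proof.
move=> Ha Hb EGa EGb; have Hab := lerD Ha Hb; split; first by lra.
move=> alphaP; have b0 : 0 <= alpha * (alpha - 4).
  case: alphaP => ?; first by rewrite mulr_le0//; lra.
  by rewrite mulr_ge0//; lra.
(* The one nonlinear fact, supplied so that [lra] can finish. *)
have := mulr_ge0 b0 (_ : 0 <= (Ga - Ea) + (Gb - Eb)).
by move=> /(_ ltac:(lra)); lra.
Qed.

Section complex_valued.
Context {R : realType} {n : nat}.
Implicit Types (f : 'rV[R]_n -> R[i]) (x : 'rV[R]_n) (z : R[i]).
Local Open Scope complex_scope.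

Local Notation re f := (fun y => complex.Re (f y)).
Local Notation im f := (fun y => complex.Im (f y)).

Lemma normc_sqr z : normc z ^+ 2 = complex.Re z ^+ 2 + complex.Im z ^+ 2.
Proof. by case: z => a b /=; rewrite sqr_sqrtr// addr_ge0// sqr_ge0. Qed.

Lemma Re_sum (F : 'I_n -> R[i]) :
  complex.Re (\sum_j F j) = \sum_j complex.Re (F j).
Proof. by apply: big_morph => // -[a b] [c d]. Qed.

Lemma Im_sum (F : 'I_n -> R[i]) :
  complex.Im (\sum_j F j) = \sum_j complex.Im (F j).
Proof. by apply: big_morph => // -[a b] [c d]. Qed.

(** Valid at the origin too, where both sides are the default value 0. *)
Lemma enormVsqr x : enorm x ^- 2 = (sqnorm x)^-1.
Proof. by rewrite sqr_sqrtr// sumr_ge0// => i _; exact: sqr_ge0. Qed.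

Lemma normc_laplacian f x :
  normc (laplacian f x) ^+ 2 = lapl (re f) x ^+ 2 + lapl (im f) x ^+ 2.
Proof. by rewrite normc_sqr Re_sum Im_sum. Qed.

Lemma normc_x_dot_gradient f x :
  normc (x_dot_gradient f x) ^+ 2 = euler (re f) x ^+ 2 + euler (im f) x ^+ 2.
Proof.
rewrite normc_sqr Re_sum Im_sum; congr (_ ^+ 2 + _ ^+ 2).
  by apply: eq_bigr => j _; rewrite !mxE/= mul0r subr0.
by apply: eq_bigr => j _; rewrite !mxE/= mul0r addr0.
Qed.

Lemma cenorm_gradient f x :
  cenorm (gradient f x) ^+ 2 = grad2 (re f) x + grad2 (im f) x.
Proof.
rewrite sqr_sqrtr; last by apply: sumr_ge0 => j _; exact: sqr_ge0.
by rewrite -big_split; apply: eq_bigr => j _; rewrite mxE normc_sqr.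
Qed.

End complex_valued.
Local Close Scope classical_set_scope.

Theorem theorem2p1 (R : realType) (alpha beta : R) (n : nat) (hn : (2 <= n)%N)
    (f : 'rV[R]_n -> R[i]) (hf : C0infty_minus0 f) :
  (integral_Rn (fun x => normc (laplacian f x) ^+ 2)
    >= ((n%:R - 4) * alpha - 2 * beta)
         * integral_Rn (fun x => enorm x ^- 2 * cenorm (gradient f x) ^+ 2)
       - alpha * (alpha - 4)
         * integral_Rn (fun x => enorm x ^- 4 * normc (x_dot_gradient f x) ^+ 2)
       + beta * ((n%:R - 4) * (alpha - 2) - beta)
         * integral_Rn (fun x => enorm x ^- 4 * normc (f x) ^+ 2))
  /\
  (alpha <= 0 \/ alpha >= 4 ->
   integral_Rn (fun x => normc (laplacian f x) ^+ 2)
    >= (alpha * (n%:R - alpha) - 2 * beta)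
         * integral_Rn (fun x => enorm x ^- 2 * cenorm (gradient f x) ^+ 2)
       + beta * ((n%:R - 4) * (alpha - 2) - beta)
         * integral_Rn (fun x => enorm x ^- 4 * normc (f x) ^+ 2)).
Proof.
pose re (g : 'rV[R]_n -> R[i]) y := complex.Re (g y).
pose im (g : 'rV[R]_n -> R[i]) y := complex.Im (g y).
have [[sre sim] cK K0] := hf.
(* The support of [f] serves as the common compact set [K] for both the real and the imaginary
   part. *)
have f0 x : ~ csupport f x -> f x = 0.
  by move=> fx; apply: contrapT => /eqP fx0; apply: fx; exact: subset_closure.
have re0 x : ~ csupport f x -> complex.Re (f x) = 0 by move=> /f0 ->.
have im0 x : ~ csupport f x -> complex.Im (f x) = 0 by move=> /f0 ->.
have w2 (x : 'rV[R]_n) : enorm x ^- 4 = (sqnorm x)^-1 ^+ 2.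
  by rewrite -enormVsqr exprVn -exprM.
(* Each of the four integrands is quadratic in [f], hence the sum of its values on the real and
   imaginary parts. *)
rewrite (_ : (fun x => normc (laplacian f x) ^+ 2) =
  fun x => lapl (re f) x ^+ 2 + lapl (im f) x ^+ 2); last first.
  by apply/funext => x; rewrite normc_laplacian.
rewrite (_ : (fun x => enorm x ^- 2 * _) =
  fun x => (sqnorm x)^-1 * grad2 (re f) x
    + (sqnorm x)^-1 * grad2 (im f) x); last first.
  by apply/funext => x; rewrite enormVsqr cenorm_gradient mulrDr.
rewrite (_ : (fun x => enorm x ^- 4 * normc (x_dot_gradient f x) ^+ 2) =
  fun x => (sqnorm x)^-1 ^+ 2 * euler (re f) x ^+ 2
    + (sqnorm x)^-1 ^+ 2 * euler (im f) x ^+ 2); last first.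
  by apply/funext => x; rewrite w2 normc_x_dot_gradient mulrDr.
rewrite (_ : (fun x => enorm x ^- 4 * normc (f x) ^+ 2) =
  fun x => (sqnorm x)^-1 ^+ 2 * complex.Re (f x) ^+ 2
    + (sqnorm x)^-1 ^+ 2 * complex.Im (f x) ^+ 2); last first.
  by apply/funext => x; rewrite w2 normc_sqr mulrDr.
rewrite (integral_RnD cK K0 (admissible_lapl_sqr cK sre re0)
  (admissible_lapl_sqr cK sim im0)).
rewrite (integral_RnD cK K0 (admissible_grad2 cK sre re0)
  (admissible_grad2 cK sim im0)).
rewrite (integral_RnD cK K0 (admissible_euler_sqr cK sre re0)
  (admissible_euler_sqr cK sim im0)).
rewrite (integral_RnD cK K0 (admissible_sqr sre re0) (admissible_sqr sim im0)).
have Rre := rellich_real cK K0 sre re0 alpha beta.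
have Rim := rellich_real cK K0 sim im0 alpha beta.
have Ere := le_integral_euler cK K0 sre re0.
have Eim := le_integral_euler cK K0 sim im0.
exact: (rellich_combine Rre Rim Ere Eim).
Qed.
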